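(* In the setting described in the context, assume $K\ge2$ and fix $i\in[N]$. Then $F_i[i,\ell,s]=0$ for all $\ell,s$, and for $m\ne i$: $F_i[m,1,s]=1$ if $s=\widetilde w_m$ and $F_i[m,1,s]=0$ otherwise. For $2\le\ell\le K-1$ and $m\ne i$, $$F_i[m,\ell,s]=\sum_{t=1}^{m-1}F_i[t,\ell-1,s-\widetilde w_m],$$ and for $K\le\ell\le N-1$, $$F_i[m,\ell,s]=\begin{cases}0 & m<i,\\ \binom{N-m}{\ell-K}\sum_{t=1}^{m-1}F_i[t,K-1,s] & m>i.\end{cases}$$
   Context: Training set $D=\{z_1,\dots,z_N\}$, $z_i=(x_i,y_i)$, validation point $z^{(\mathrm{val})}=(x^{(\mathrm{val})},y^{(\mathrm{val})})$, points indexed so that $d(x_1,x^{(\mathrm{val})})\le\cdots\le d(x_N,x^{(\mathrm{val})})$. For $S\subseteq D$ and $1\le j\le|S|$, $\alpha(S,j)$ is the $j$-th smallest index of a point of $S$. Integer $K$; weights $w_j\in[0,1]$; signed weights $\widetilde w_j=w_j$ if $y_j=y^{(\mathrm{val})}$, $-w_j$ otherwise. $\mathrm{Cond}_{KNN}$ for $S\subseteq D\setminus\{z_i\}$: $z_i$ is among the $K$ nearest neighbors of $x^{(\mathrm{val})}$ in $S\cup\{z_i\}$, i.e. $|\{z_j\in S:j<i\}|\le K-1$. $F_i[m,\ell,s]$ (for $m\in[N]$, $1\le\ell\le N-1$, $s\in\mathbb{R}$): number of $S\subseteq D\setminus\{z_i\}$ with $|S|=\ell$ satisfying $\mathrm{Cond}_{KNN}$,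 $\alpha(S,\min(\ell,K))=m$, and $\sum_{j=1}^{\min(\ell,K-1)}\widetilde w_{\alpha(S,j)}=s$. $\binom{a}{b}=0$ when $b>a$. *)

(* Defs.v *)
From mathcomp Require Export all_boot all_order all_algebra.
From mathcomp Require Export reals.

Set Implicit Arguments.
Unset Strict Implicit.
Unset Printing Implicit Defensive.

Import Order.TTheory GRing.Theory Num.Theory.
Local Open Scope ring_scope.

(* The point z_{k+1} of the training set is the ordinal k : 'I_N (so indices
   start at 0), and a subset S of D is a {set 'I_N}: repeated data points with
   different indices remain different. *)

(* alpha i0 S j is the j-th smallest index of S for 1 <= j <= #|S|: the rank j
   starts at 1, and i0 is an unused default value.  enum S lists S in
   increasing order, see sorted_enum_ord. *)
Definition alpha (N : nat) (i0 : 'I_N) (S : {set 'I_N}) (j : nat) : 'I_N :=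
  nth i0 (enum S) j.-1.

Lemma sorted_enum_ord (N : nat) (S : {set 'I_N}) :
  sorted ltn [seq val k | k <- enum S].
Proof.
rewrite sorted_map {1}/enum_mem sorted_filter //; first exact: ltn_trans.
by rewrite -enumT -sorted_map val_enum_ord iota_ltn_sorted.
Qed.

Definition signed_weight (R : realType) (N : nat) (Y : eqType)
    (y : 'I_N -> Y) (yval : Y) (w : 'I_N -> R) (j : 'I_N) : R :=
  if y j == yval then w j else - w j.

Definition cond_KNN (N K : nat) (i : 'I_N) (S : {set 'I_N}) : bool :=
  (#|[set j in S | (j < i)%N]| <= K - 1)%N.

(* F K wt i m l s is F_i[m, l, s], where wt is the family of signed weights. *)
Definition F (R : realType) (N K : nat) (wt : 'I_N -> R)
    (i m : 'I_N) (l : nat) (s : R) : nat :=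
  #|[set S : {set 'I_N} |
      [&& i \notin S, #|S| == l, cond_KNN K i S,
          alpha i S (minn l K) == m &
          \sum_(1 <= j < (minn l (K - 1)).+1) wt (alpha i S j) == s]]|.

(* Main.v *)
Require Import Defs.
From mathcomp Require Import all_boot all_order all_algebra.
From mathcomp Require Import reals zify.

Set Implicit Arguments.
Unset Strict Implicit.
Unset Printing Implicit Defensive.

Import Order.TTheory GRing.Theory Num.Theory.
Local Open Scope ring_scope.

(** Cut a set [S] at one of its points [m] into the part below [m], [m] itself
    and the part above [m].  That [m] has rank [j] in [S] only says that the
    lower part has [j - 1] elements, so [F_i[m, l, s]] counts independent choices
    of a lower and an upper part.  The lower parts of size [r] and weight [s] are
    in turn classified by their largest element [t < m], which gives
    [sum_(t < m) F_i[t, r, s]]; the upper part is empty for [l < K] and an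
    arbitrary subset of size [l - K] otherwise. *)

Definition below (N : nat) (m : 'I_N) : {set 'I_N} := [set k : 'I_N | (k < m)%N].
Definition above (N : nat) (m : 'I_N) : {set 'I_N} := [set k : 'I_N | (m < k)%N].

(** * Cutting a set at one of its points, and reading off ranks and sums *)

Section Splitting.

Variable N : nat.
Implicit Types (m i : 'I_N) (S A B : {set 'I_N}).

Lemma card_above m : #|above m| = (N - m.+1)%N.
Proof.
have -> : above m = ~: (widen_ord (ltn_ord m) @: [set: 'I_m.+1]).
  apply/setP => k; rewrite !inE ltnNge; congr negb.
  apply/idP/imsetP => [km|[j _ ->]]; last by rewrite -ltnS /= ltn_ord.
  by exists (Ordinal (km : (k < m.+1)%N)) => //; apply: val_inj.
rewrite cardsCs setCK card_imset ?cardsT ?card_ord //.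
by move=> a b /(congr1 val) /= ab; apply: val_inj.
Qed.

Lemma splitU_at m S : m \in S ->
  S :&: below m :|: (m |: S :&: above m) = S.
Proof.
move=> mS; apply/setP => k; rewrite !inE.
case: (k =P m) => [->|/eqP km]; first by rewrite mS orbT.
by rewrite -andb_orr /= -neq_ltn km andbT.
Qed.

(** Both lists are strictly increasing and have the same members, hence coincide. All facts about
    ranks below are read off from this concatenation. *)
Lemma enum_split m S : m \in S ->
  enum S = enum (S :&: below m) ++ m :: enum (S :&: above m).
Proof.
move=> mS; apply: (inj_map val_inj).
apply: (irr_sorted_eq ltn_trans ltnn); first exact: sorted_enum_ord.
- rewrite map_cat /= (sorted_pairwise ltn_trans) pairwise_cat /=.
  rewrite -!(sorted_pairwise ltn_trans) !sorted_enum_ord !andbT /=.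
  apply/andP; split.
    apply/allrelP => _ c /mapP[a aA ->]; rewrite inE.
    move: aA; rewrite mem_enum !inE => /andP[_ am].
    case/predU1P => [->//|/mapP[b + ->]].
    by rewrite mem_enum !inE => /andP[_]; apply: ltn_trans.
  by apply/allP => _ /mapP[b + ->]; rewrite mem_enum !inE => /andP[].
- apply: eq_mem_map => k.
  by rewrite mem_cat inE !mem_enum -[in LHS](splitU_at mS) !inE.
Qed.

Lemma card_split m S : m \in S ->
  #|S| = (#|S :&: below m| + #|S :&: above m|).+1.
Proof. by move=> mS; rewrite cardE (enum_split mS) size_cat /= -!cardE addnS. Qed.

Lemma size_enum_set S : size (enum S) = #|S|.
Proof. by rewrite -cardE. Qed.

Lemma alpha_in i S j : (0 < j <= #|S|)%N -> alpha i S j \in S.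
Proof. by move=> jS; rewrite -mem_enum mem_nth // size_enum_set; lia. Qed.

(** A point [m] of [S] stands at position [#|S :&: below m|] of the duplicate-free list [enum S], so
    comparing entries amounts to comparing positions. Ranks start at 1 and positions at 0, whence
    [j.-1]. *)
Lemma alpha_eqE i m S j : (0 < j <= #|S|)%N ->
  (alpha i S j == m) = (m \in S) && (#|S :&: below m| == j.-1).
Proof.
move=> jS; case: (boolP (m \in S)) => [mS|]; last first.
  by apply: contraNF => /eqP <-; apply: alpha_in.
have am : nth i (enum S) #|S :&: below m| = m.
  by rewrite (enum_split mS) nth_cat size_enum_set ltnn subnn.
have jn : (j.-1 < size (enum S))%N by rewrite size_enum_set; lia.
have cn : (#|S :&: below m| < size (enum S))%N.
  by rewrite size_enum_set (card_split mS) ltnS leq_addr.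
by rewrite /alpha -[X in _ == X]am (nth_uniq i jn cn (enum_uniq S)) eq_sym.
Qed.

(** The point of rank [#|S|] is the maximum of [S]: all other points are counted below it, so none
    is left above. *)
Lemma alpha_last_lt i m S : (0 < #|S|)%N ->
  (alpha i S #|S| < m)%N = (S \subset below m).
Proof.
move=> S0; have aS : alpha i S #|S| \in S by rewrite alpha_in ?S0 /=.
apply/idP/subsetP => [am k kS|/(_ _ aS)]; last by rewrite inE.
have := eqxx (alpha i S #|S|); rewrite alpha_eqE ?S0 ?leqnn // => /andP[_ /eqP cS].
move: (card_split aS); rewrite cS => e.
have /cards0_eq e0 : #|S :&: above (alpha i S #|S|)| = 0%N by lia.
rewrite inE (leq_ltn_trans _ am) // leqNgt; apply/negP => ak.
by have := in_set0 k; rewrite -e0 !inE kS ak.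
Qed.

Lemma sum_alpha (R : nmodType) (wt : 'I_N -> R) i S :
  \sum_(1 <= j < #|S|.+1) wt (alpha i S j) = \sum_(k in S) wt k.
Proof.
by rewrite -[RHS]big_enum (big_nth i) size_enum_set big_add1.
Qed.

Lemma sum_alpha_below (R : nmodType) (wt : 'I_N -> R) i m S : m \in S ->
  \sum_(1 <= j < #|S :&: below m|.+1) wt (alpha i S j) =
  \sum_(k in S :&: below m) wt k.
Proof.
move=> mS; rewrite -(sum_alpha wt i); apply: eq_big_nat => j jb.
by rewrite /alpha (enum_split mS) nth_cat size_enum_set ifT //; lia.
Qed.

(** Cutting at [m] is a bijection from the sets containing [m] to the pairs of a lower and an upper
    part, with inverse sending [(A, B)] to the union of [A], [m] and [B]. *)
Lemma card_split_pred m (P Q : pred {set 'I_N}) :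
  #|[set S : {set 'I_N} | [&& m \in S, P (S :&: below m) & Q (S :&: above m)]]| =
  (#|[set A : {set 'I_N} | (A \subset below m) && P A]| *
   #|[set B : {set 'I_N} | (B \subset above m) && Q B]|)%N.
Proof.
(* Cutting a glued set returns its two pieces; this gives both the conditions on the image and the
   injectivity of gluing. *)
have glue A B : A \subset below m -> B \subset above m ->
    ((A :|: (m |: B)) :&: below m = A) * ((A :|: (m |: B)) :&: above m = B).
  move=> /subsetP sA /subsetP sB; split; apply/setP => k; rewrite !inE.
    have := sA k; have := sB k; rewrite !inE.
    case: (k \in A) => [_ ->//|]; case: (k \in B) => [/(_ isT)|_ _] /=.
      by move=> mk _; rewrite orbT; lia.
    by rewrite orbF; case: eqP => [->|]; rewrite ?ltnn.
  have := sA k; have := sB k; rewrite !inE.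
  case: (k \in B) => [-> //|_]; first by rewrite !orbT.
  case: (k \in A) => [/(_ isT) km|_] /=; first lia.
  by rewrite orbF; case: eqP => [->|]; rewrite ?ltnn.
rewrite -cardsX -(card_in_imset (f := fun p => p.1 :|: (m |: p.2))).
  apply: eq_card => S; apply/idP/imsetP.
    rewrite inE => /and3P[mS PS QS].
    by exists (S :&: below m, S :&: above m); rewrite ?inE /= ?subsetIr ?PS ?splitU_at.
  case=> -[A B]; rewrite !inE /= => /andP[/andP[sA PA] /andP[sB QB]] ->.
  by rewrite !inE eqxx orbT !glue //= PA QB.
move=> -[A B] [A' B']; rewrite !inE /=.
move=> /andP[/andP[sA _] /andP[sB _]] /andP[/andP[sA' _] /andP[sB' _]] e.
have [eA eB] := glue A B sA sB; have [eA' eB'] := glue A' B' sA' sB'.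
by congr (_, _); [rewrite -eA e | rewrite -eB e].
Qed.

End Splitting.

(** * Counting lower parts and evaluating [F] in each range of [l] *)

Section Recursion.

Variables (R : realType) (N K : nat) (wt : 'I_N -> R) (i : 'I_N).
Implicit Types (m : 'I_N) (S A : {set 'I_N}) (s : R).

(** The neighbor condition is left out because it holds automatically wherever these sets are used;
    the sum no longer mentions ranks. *)
Definition lower_parts m (r : nat) s : {set {set 'I_N}} :=
  [set A : {set 'I_N} | (A \subset below m) &&
           [&& i \notin A, #|A| == r & \sum_(k in A) wt k == s]].

Lemma cond_KNN_card S : (#|S| <= K - 1)%N -> cond_KNN K i S.
Proof.
apply: leq_trans; apply: subset_leq_card.
by apply/subsetP => k; rewrite inE => /andP[].
Qed.

Lemma lower_parts0 m s : #|lower_parts m 0 s| = (s == 0).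
Proof.
have -> : lower_parts m 0 s = if s == 0 then [set set0] else set0.
  apply/setP => A; rewrite inE; case: (eqVneq A set0) => [->|A0].
    by rewrite sub0set inE cards0 big_set0 eqxx eq_sym; case: eqP; rewrite !inE ?eqxx.
  rewrite cards_eq0 (negPf A0) !andbF.
  by case: eqP; rewrite !inE ?(negPf A0).
by case: eqP; rewrite ?cards1 ?cards0.
Qed.

(** Lower parts are sorted by their largest element [t], the point of rank [r]. As [r] is at most
    [K - 1], both minima in [F] equal [r] and the neighbor condition is automatic. *)
Lemma sumF_lower_parts m r s : (0 < r <= K - 1)%N ->
  (\sum_(t < N | (t < m)%N) F K wt i t r s)%N = #|lower_parts m r s|.
Proof.
move=> rK; rewrite -[RHS]sum1_card.
rewrite (partition_big (fun A => alpha i A r) (fun t => (t < m)%N)) /=; last first.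
  move=> A; rewrite !inE => /and4P[sA _ /eqP cA _].
  by rewrite -cA alpha_last_lt // cA; lia.
apply: eq_bigr => t tm; rewrite sum1dep_card; apply: eq_card => A; rewrite !inE.
have [-> ->] : minn r K = r /\ minn r (K - 1) = r by lia.
case: eqP => cA; last by rewrite !andbF.
rewrite cond_KNN_card ?cA /=; last lia.
rewrite -[X in \sum_(1 <= j < X.+1) _]cA sum_alpha.
case: eqP => at_; last by rewrite !andbF.
rewrite -(alpha_last_lt i); last by lia.
by rewrite cA at_ tm /= andbT.
Qed.

(** Here [m] has the last rank, so the upper part is empty. The sum covers all of [S], including
    [m], which shifts the target by [wt m]. *)
Lemma F_small m l s : (0 < l <= K - 1)%N -> m != i ->
  F K wt i m l s = #|lower_parts m (l - 1) (s - wt m)|.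
Proof.
move=> lK mi; pose P A := [&& i \notin A, #|A| == (l - 1)%N
  & \sum_(k in A) wt k == s - wt m].
have := card_split_pred m P (fun B => #|B| == 0%N).
rewrite cards_draws bin0 muln1 => <-.
suff e S : [&& i \notin S, #|S| == l, cond_KNN K i S, alpha i S (minn l K) == m
      & \sum_(1 <= j < (minn l (K - 1)).+1) wt (alpha i S j) == s] =
    [&& m \in S, P (S :&: below m) & #|S :&: above m| == 0%N].
  by apply: eq_card => S; rewrite !inE e.
have [-> ->] : minn l K = l /\ minn l (K - 1) = l by lia.
case: (boolP (m \in S)) => mS /=; last first.
  case: (#|S| =P l) => [cS|_]; last by rewrite andbF.
  by rewrite alpha_eqE ?cS ?(negPf mS) ?andbF //; lia.
have cS := card_split mS.
case: (#|S| =P l) => cSl /=; last first.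
  by rewrite andbF; apply/esym/negP => /andP[/and3P[_ /eqP cA _] /eqP cB]; case: cSl; rewrite cS cA cB; lia.
rewrite cond_KNN_card ?cSl //=; last lia.
rewrite alpha_eqE ?cSl ?mS //=; last lia.
(* With a nonempty upper part, fewer than [l - 1] points lie below [m], so both sides are false. *)
case: (#|S :&: above m| =P 0%N) => [B0|B0]; last first.
  rewrite andbF; apply/negP => /and3P[_ /eqP cA _].
  by move: cS; rewrite cSl cA; lia.
have SE : S = m |: S :&: below m.
  by rewrite -[LHS](splitU_at mS) (cards0_eq B0) setU0 setUC.
have sS : \sum_(k in S) wt k = wt m + \sum_(k in S :&: below m) wt k.
  by rewrite [in LHS]SE big_setU1 // !inE ltnn andbF.
(* This is where [m != i] enters. *)
have iS : (i \in S) = (i \in S :&: below m).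
  by rewrite [in LHS]SE in_setU1 eq_sym (negPf mi).
rewrite /P -iS andbT subn1 -[X in \sum_(1 <= j < X.+1) _]cSl sum_alpha sS.
by rewrite [_ == s - wt m]eq_sym subr_eq [s == _]eq_sym addrC.
Qed.

(** Rank [K] at [m] leaves [K - 1] points below, exactly those summed, so [wt m] does not enter. The
    other [l - K] points are chosen freely among the [N - m.+1] above [m]. *)
Lemma F_large m l s : (0 < K <= l)%N -> (i < m)%N ->
  F K wt i m l s = (#|lower_parts m (K - 1) s| * 'C(N - m.+1, l - K))%N.
Proof.
move=> Kl im; pose P A := [&& i \notin A, #|A| == (K - 1)%N
  & \sum_(k in A) wt k == s].
have := card_split_pred m P (fun B => #|B| == (l - K)%N).
rewrite cards_draws card_above => <-.
suff e S : [&& i \notin S, #|S| == l, cond_KNN K i S, alpha i S (minn l K) == m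
      & \sum_(1 <= j < (minn l (K - 1)).+1) wt (alpha i S j) == s] =
    [&& m \in S, P (S :&: below m) & #|S :&: above m| == (l - K)%N].
  by apply: eq_card => S; rewrite !inE e.
have [-> ->] : minn l K = K /\ minn l (K - 1) = (K - 1)%N by lia.
case: (boolP (m \in S)) => mS /=; last first.
  case: (#|S| =P l) => [cS|_]; last by rewrite andbF.
  by rewrite alpha_eqE ?cS ?(negPf mS) ?andbF //; lia.
have cS := card_split mS; rewrite /P in_setI [i \in below m]inE im andbT.
case: (#|S| =P l) => cSl /=; last first.
  by rewrite andbF; apply/esym/negP => /andP[/and3P[_ /eqP cA _] /eqP cB]; case: cSl; rewrite cS cA cB; lia.
rewrite alpha_eqE ?cSl ?mS //= -subn1.
case: (#|S :&: below m| =P (K - 1)%N) => [cA|]; last by rewrite !andbF.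
have -> : #|S :&: above m| = (l - K)%N by lia.
(* Since [i < m], the points of [S] before [i] are among the [K - 1] points below [m]. *)
have -> : cond_KNN K i S.
  rewrite /cond_KNN -cA; apply: subset_leq_card; apply/subsetP => k.
  by rewrite !inE => /andP[-> /ltn_trans]; apply.
by rewrite -[X in \sum_(1 <= j < X.+1) _]cA sum_alpha_below // eqxx !andbT.
Qed.

(** The rank [minn l K] is valid, so its point lies in [S], whereas [i] does not. *)
Lemma F_self l s : (0 < l)%N -> (0 < K)%N -> F K wt i i l s = 0%N.
Proof.
move=> l0 K0; apply: eq_card0 => S; rewrite !inE.
apply/negP => /and5P[/negP iS /eqP cS _ /eqP aS _]; apply: iS.
by rewrite -[X in X \in _]aS alpha_in // cS; lia.
Qed.

(** The point [m] and the [K - 1] points below it would be [K] points of [S] before [i], against the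
    neighbor condition. *)
Lemma F_large_lt m l s : (0 < K <= l)%N -> (m < i)%N -> F K wt i m l s = 0%N.
Proof.
move=> Kl mi; apply: eq_card0 => S; rewrite !inE.
have -> : minn l K = K by lia.
apply/negP => /and5P[_ /eqP cS cond + _].
rewrite alpha_eqE ?cS => [/andP[mS /eqP cA]|]; last lia.
suff : (#|m |: S :&: below m| <= K - 1)%N.
  by rewrite cardsU1 !inE ltnn andbF /= cA; lia.
apply: leq_trans cond; apply: subset_leq_card; apply/subsetP => k.
by rewrite !inE => /predU1P[->|/andP[-> /ltn_trans]]; [rewrite mS mi|apply].
Qed.

End Recursion.

Theorem theorem12 (R : realType) (X : Type) (Y : eqType) (d : X -> X -> R)
    (N K : nat) (x : 'I_N -> X) (y : 'I_N -> Y) (xval : X) (yval : Y)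
    (w : 'I_N -> R)
    (hsort : forall j k : 'I_N, (j <= k)%N -> d (x j) xval <= d (x k) xval)
    (hw : forall j : 'I_N, 0 <= w j <= 1)
    (hK : (2 <= K)%N) (i : 'I_N) :
  let wt := signed_weight y yval w in
  [/\ forall (l : nat) (s : R), (1 <= l)%N -> F K wt i i l s = 0%N,
      forall (m : 'I_N) (s : R), m != i ->
        F K wt i m 1 s = if s == wt m then 1%N else 0%N,
      forall (l : nat) (m : 'I_N) (s : R), (2 <= l <= K - 1)%N -> m != i ->
        F K wt i m l s = (\sum_(t < N | (t < m)%N) F K wt i t (l - 1) (s - wt m))%N
    & forall (l : nat) (m : 'I_N) (s : R), (K <= l <= N - 1)%N ->
        ((m < i)%N -> F K wt i m l s = 0%N) /\
        ((i < m)%N -> F K wt i m l s =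
           ('C(N - m.+1, l - K) * \sum_(t < N | (t < m)%N) F K wt i t (K - 1) s)%N)].
Proof.
move=> wt; split.
- by move=> l s l1; rewrite F_self //; lia.
(* For [l = 1] the only lower part is the empty set, of weight 0, which forces [s = wt m]. *)
- by move=> m s mi; rewrite F_small ?lower_parts0 ?subr_eq0; [case: eqP|lia|].
- by move=> l m s lK mi; rewrite F_small ?sumF_lower_parts //; lia.
- move=> l m s lK; split=> mi; first by rewrite F_large_lt //; lia.
  by rewrite F_large ?sumF_lower_parts 1?mulnC //; lia.
Qed.
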